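(* Let $G$ be a connected graph on $n$ vertices, with $m$ edges and smallest degree $\delta$. Then $$S_L(\mathcal{T}(G))\geq\left|\frac{2m+2n}{n}-2\delta\right|.$$
   Context: Graphs are finite, simple and undirected. The line graph $\mathcal{L}(G)$ has the edges of $G$ as vertices, two being adjacent if the corresponding edges share a vertex. The total graph $\mathcal{T}(G)$ has vertex set $V(G)\cup E(G)$; two vertices of $\mathcal{T}(G)$ are adjacent if the corresponding elements are two adjacent vertices of $G$, or two edges of $G$ adjacent in $\mathcal{L}(G)$, or a vertex and an edge of $G$ incident with each other. For a graph $H$ on $N$ vertices with Laplacian eigenvalues $\mu_1\geq\mu_2\geq\cdots\geq\mu_{N-1}\geq\mu_N=0$ (the eigenvalues of $L(H)=D(H)-A(H)$, where $A(H)$ is the adjacency matrix and $D(H)$ the diagonal matrix of vertex degrees), the Laplacian spread is $S_L(H)=\mu_1-\mu_{N-1}$.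
   Formalization: The graph is assumed to have n ≥ 3 vertices: for n = 2 the graph is K_2, T(K_2) = K_3 has Laplacian spread 0 while the right-hand side is 1, and for n = 1 the eigenvalue μ_{N-1} of T(K_1) = K_1 does not exist. *)

(* Defs.v *)
From mathcomp Require Import all_boot all_order all_algebra.
From mathcomp.real_closed Require Import polyrcf.

Set Implicit Arguments.
Unset Strict Implicit.
Unset Printing Implicit Defensive.

Import Order.TTheory GRing.Theory Num.Theory.
Local Open Scope ring_scope.

Record sgraph := SGraph {
  svertex :> finType;
  sedge : rel svertex;
  sedge_sym : symmetric sedge;
  sedge_irrefl : irreflexive sedge
}.
Arguments sedge {s}.

Definition connected_graph (G : sgraph) : Prop :=
  (0 < #|G|)%N /\ forall x y : G, connect sedge x y.

Definition degree (G : sgraph) (x : G) : nat := #|[set y : G | sedge x y]|.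

(* Degrees are smaller than #|G|, so the default value #|G| only matters for
   the graph without vertices. *)
Definition min_degree (G : sgraph) : nat := \big[minn/#|G|]_(x : G) degree x.

Definition edges (G : sgraph) : {set {set G}} :=
  [set A : {set G} | [exists x, [exists y, sedge x y && (A == [set x; y])]]].

Definition edge_type (G : sgraph) : finType := {A : {set G} | A \in edges G}.

Section LineGraph.
Variable G : sgraph.

Definition line_rel : rel (edge_type G) :=
  fun a b => (a != b) && (val a :&: val b != set0).

Lemma line_rel_sym : symmetric line_rel.
Proof. by move=> a b; rewrite /line_rel eq_sym setIC. Qed.

Lemma line_rel_irrefl : irreflexive line_rel.
Proof. by move=> a; rewrite /line_rel eqxx. Qed.

Definition line_graph : sgraph := SGraph line_rel_sym line_rel_irrefl.

End LineGraph.

Section TotalGraph.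
Variable G : sgraph.

Definition total_rel : rel (G + edge_type G)%type :=
  fun u v => match u, v with
  | inl x, inl y => sedge x y
  | inr a, inr b => @sedge (line_graph G) a b
  | inl x, inr a | inr a, inl x => x \in val a
  end.

Lemma total_rel_sym : symmetric total_rel.
Proof. by move=> [x|a] [y|b] //=; [exact: sedge_sym | exact: line_rel_sym]. Qed.

Lemma total_rel_irrefl : irreflexive total_rel.
Proof. by move=> [x|a] /=; [exact: sedge_irrefl | exact: line_rel_irrefl]. Qed.

Definition total_graph : sgraph := SGraph total_rel_sym total_rel_irrefl.

End TotalGraph.

Section Laplacian.
Variables (R : rcfType) (H : sgraph).

Definition adjacency_mx : 'M[R]_#|H| :=
  \matrix_(i, j) (sedge (enum_val i) (enum_val j))%:R.

Definition degree_mx : 'M[R]_#|H| :=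
  diag_mx (\row_i (degree (enum_val i))%:R).

Definition laplacian : 'M[R]_#|H| := degree_mx - adjacency_mx.

(* The eigenvalues in decreasing order, each repeated according to its
   multiplicity as a root of the characteristic polynomial. *)
Definition laplacian_spectrum : seq R :=
  let p := char_poly laplacian in
  sort >=%O (flatten [seq nseq (mup x p) x | x <- rootsR p]).

(* Numbered from 1, so that laplacian_eig 1 is the largest eigenvalue. *)
Definition laplacian_eig (k : nat) : R := nth 0 laplacian_spectrum k.-1.

(* Meaningful only when H has at least two vertices. *)
Definition laplacian_spread : R := laplacian_eig 1 - laplacian_eig #|H|.-1.

End Laplacian.

(* Main.v *)
Require Import Defs.
From mathcomp Require Import all_boot all_order all_algebra.
From mathcomp Require Import zify ring lra.
From mathcomp.real_closed Require Import polyrcf complex.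
Import Order.TTheory GRing.Theory Num.Theory.
Local Open Scope ring_scope.

(** Write T for the total graph and N = n + m for its number of vertices. Both
    a := (2m + 2n) / n and 2 delta lie in the interval from mu_(N-1) to mu_1, so
    their distance is at most mu_1 - mu_(N-1).

    The membership in the interval comes from test vectors. For f on the
    vertices of H, let dirichlet f be the sum of (f u - f v)^2 over ordered
    adjacent pairs, that is 2 f L f^T. The Rayleigh principle says
    dirichlet f <= 2 mu_1 |f|^2 for all f (dirichlet_le_max) and
    2 mu_(N-1) |f|^2 <= dirichlet f if the values of f sum to 0
    (dirichlet_ge_second).

    - a: the vector equal to m on the vertices of G and to - n on its edges sums
      to 0, and its Rayleigh quotient is exactly a, because T has 2m incidences
      between vertices and edges of G (vertex_edge_vector_dirichlet).
    - 2 delta: in any graph H, the indicator of a vertex u has Rayleigh quotient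
      deg u, whence deg u <= mu_1 (degree_le_largest). If u has a non-neighbour,
      then its neighbours separate it from its non-neighbours, which yields
      mu_(N-1) <= deg u (second_le_degree). Both apply to H = T with u a vertex
      of G of degree delta: its degree in T is 2 delta (degree_total_vertex), and
      it has a non-neighbour in T (total_graph_nonneighbour).

    The Rayleigh principle for the sorted list of roots of the characteristic
    polynomial is derived from the unitary diagonalization of the Laplacian over
    the algebraically closed field R[i]. *)

(** * Roots of a split polynomial, with multiplicity *)

Lemma char_poly_conjugate (F : fieldType) n (P D : 'M[F]_n) :
  P \in unitmx -> char_poly (invmx P *m D *m P) = char_poly D.
Proof.
move=> Pu; rewrite /char_poly.
have PV : map_mx polyC (invmx P) *m map_mx polyC P = 1%:M.
  by rewrite -map_mxM mulVmx // map_mx1.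
have -> : char_poly_mx (invmx P *m D *m P) =
    map_mx polyC (invmx P) *m char_poly_mx D *m map_mx polyC P.
  rewrite /char_poly_mx mulmxBr mulmxBl !map_mxM; congr (_ - _).
  by rewrite mul_mx_scalar -scalemxAl PV scalemx1.
by rewrite !det_mulmx mulrAC -det_mulmx PV det1 mul1r.
Qed.

Lemma mup_prod_XsubC (F : fieldType) (s : seq F) x :
  mup x (\prod_(a <- s) ('X - a%:P)) = count_mem x s.
Proof.
elim: s => [|a s IHs].
  by rewrite big_nil mupNroot // rootC oner_eq0.
rewrite big_cons mupM ?polyXsubC_eq0 ?IHs //=; last first.
  by rewrite monic_neq0 // monic_prod_XsubC.
by rewrite -['X - _]expr1 mup_XsubCX; case: eqP.
Qed.

(** The list of roots repeated by multiplicity recovers the multiset of linear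
    factors: both sides contain x exactly mup x p times. *)
Lemma roots_with_mult_perm (R : rcfType) (s : seq R) :
  let p := \prod_(a <- s) ('X - a%:P) in
  perm_eq (flatten [seq nseq (mup x p) x | x <- rootsR p]) s.
Proof.
rewrite /=; set p := \prod_(a <- s) _.
have p0 : p != 0 by rewrite monic_neq0 // monic_prod_XsubC.
have memR x : (x \in rootsR p) = (x \in s).
  by have := roots_on_rootsR p0 x; rewrite in_itv /= root_prod_XsubC.
apply/allP => x _ /=; apply/eqP; rewrite count_flatten -map_comp.
have -> : count_mem x s = if x \in rootsR p then count_mem x s else 0%N.
  by rewrite memR; case: ifP => // /negbT /count_memPn.
have: uniq (rootsR p) by exact: uniq_roots.
elim: (rootsR p) => //= a t IHt /andP[at' ut].
rewrite IHt // count_nseq /= inE mup_prod_XsubC.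
have [ax |ax] := eqVneq a x; last by [].
by rewrite -ax (negPf at') mul1n addn0.
Qed.

(** * Diagonalization of real symmetric matrices *)

Section SpectralTheorem.
Local Open Scope sesquilinear_scope.
Context {R : rcfType} {n : nat}.
Local Notation toC := (real_complex R).

Lemma conj_toC (x : R) : (toC x)^* = toC x.
Proof. by apply: conj_Creal; rewrite complex_real. Qed.

(** A real symmetric matrix is hermitian over R[i]: it is unitarily
    diagonalizable there, with real eigenvalues. The matrix P may have non-real
    entries; this is harmless, since only the squared moduli of coordinates
    enter below. *)
Lemma real_spectral_theorem (A : 'M[R]_n) : A^T = A ->
  exists (P : 'M[R[i]]_n) (r : 'I_n -> R),
    P \is unitarymx /\
    map_mx toC A = invmx P *m diag_mx (\row_i toC (r i)) *m P.
Proof.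
move=> Asym; set B := map_mx toC A.
have Bherm : B \is hermsymmx.
  apply/is_hermitianmxP; rewrite expr0 scale1r {1}/B -{1}Asym.
  by apply/matrixP=> i j; rewrite !mxE conj_toC.
exists (spectralmx B), (fun i => complex.Re (spectral_diag B 0 i)).
split; first exact: spectral_unitarymx.
rewrite {1}(orthomx_spectralP (hermitian_normalmx Bherm)).
congr (_ *m diag_mx _ *m _); apply/rowP => i; rewrite mxE.
apply/esym/RRe_real; have := hermitian_spectral_diag_real Bherm.
by move/mxOverP; apply.
Qed.

End SpectralTheorem.

(** * Ends of a decreasing rearrangement *)

Lemma sort_ge_head (R : realDomainType) (s : seq R) x :
  x \in s -> x <= nth 0 (sort >=%O s) 0.
Proof.
rewrite -(mem_sort >=%O) => /(nthP 0); case=> i; rewrite size_sort => si <-.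
apply: (@sorted_leq_nth _ >=%O _ _ 0 (sort >=%O s)) => //.
- by move=> y z t /[swap]; apply: le_trans.
- by move=> y; exact: lexx.
- by apply: (@sort_sorted _ >=%O) => y z; exact: le_total.
- by rewrite inE size_sort (leq_ltn_trans _ si).
- by rewrite inE size_sort.
Qed.

(** The exceptional index i0 is where the last entry of the sorted list comes
    from. Keeping track of an index rather than of a value is what handles
    repeated values. *)
Lemma sort_ge_penultimate (R : realDomainType) n (r : 'I_n -> R) : (1 < n)%N ->
  exists i0, forall i, i != i0 -> nth 0 (sort >=%O (codom r)) n.-2 <= r i.
Proof.
move=> n1; rewrite codomE sort_map.
set t := sort _ _.
have st : size t = n by rewrite size_sort size_enum_ord.
have tmem i : i \in t by rewrite mem_sort mem_enum.
have tuniq : uniq t by rewrite sort_uniq enum_uniq.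
have n0 : (0 < n)%N by exact: ltnW.
exists (nth (Ordinal n0) t n.-1) => i ii0.
have it : (index i t < n)%N by rewrite -[X in (_ < X)%N]st index_mem.
have it2 : (index i t <= n.-2)%N.
  have : index i t != n.-1.
    by apply: contraNneq ii0 => <-; rewrite nth_index.
  by move: it n1; clear; lia.
rewrite -[i in r i](nth_index (Ordinal n0) (tmem i)) (nth_map (Ordinal n0)); last first.
  by rewrite st; move: n1; clear; lia.
apply: (@sorted_leq_nth _ (relpre r >=%O) _ _ (Ordinal n0) t) => //.
- by move=> y z u /= /[swap]; apply: le_trans.
- by move=> y; exact: lexx.
- by apply: (@sort_sorted _ (relpre r >=%O)) => y z; exact: le_total.
- by rewrite inE [X in (_ < X)%N]st.
- by rewrite inE st; move: n1; clear; lia.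
Qed.

(** Ties the spectrum, defined through roots of the characteristic polynomial,
    to the diagonal entries r that appear in Rayleigh quotients. *)
Lemma laplacian_diagonalization (R : rcfType) (H : sgraph) :
  exists (P : 'M[R[i]]_#|H|) (r : 'I_#|H| -> R),
  [/\ P \is unitarymx,
      map_mx (real_complex R) (laplacian R H) =
        invmx P *m diag_mx (\row_i (real_complex R) (r i)) *m P &
      laplacian_spectrum R H = sort >=%O (codom r)].
Proof.
have Lsym : (laplacian R H)^T = laplacian R H.
  rewrite linearB /= tr_diag_mx; congr (_ - _).
  by apply/matrixP => i j; rewrite !mxE sedge_sym.
have [P [r [Pu LE]]] := real_spectral_theorem _ Lsym.
exists P, r; split => //.
have charE : char_poly (laplacian R H) = \prod_(a <- codom r) ('X - a%:P).
  apply: (map_inj_poly (@complexI R) (rmorph0 _)).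
  rewrite map_char_poly LE char_poly_conjugate ?unitarymx_unit //.
  rewrite char_poly_trig ?diag_mx_is_trig // rmorph_prod big_map big_enum /=.
  apply: eq_bigr => i _; rewrite !mxE eqxx mulr1n rmorphB /= map_polyX map_polyC //.
rewrite /laplacian_spectrum charE; apply/perm_sortP.
- by move=> x y; exact: le_total.
- by move=> x y z /[swap]; apply: le_trans.
- by move=> x y /andP[? ?]; apply/le_anti/andP.
- exact: roots_with_mult_perm.
Qed.

(** * The quadratic form of the Laplacian *)

Section Dirichlet.
Context {R : rcfType} {H : sgraph}.
Implicit Types f : H -> R.

(** Each edge is counted twice, once in each direction. *)
Definition dirichlet f : R := \sum_u \sum_(v | sedge u v) (f u - f v) ^+ 2.

Definition row_of f : 'rV[R]_#|H| := \row_i f (enum_val i).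

Lemma sum_enum_val (V : nmodType) (F : H -> V) :
  \sum_(i < #|H|) F (enum_val i) = \sum_u F u.
Proof. by rewrite [RHS](big_enum_val (A := H) F). Qed.

Lemma dirichlet_ge0 f : 0 <= dirichlet f.
Proof. by apply: sumr_ge0 => u _; apply: sumr_ge0 => v _; exact: sqr_ge0. Qed.

Lemma row_of_sqnorm f : (row_of f *m (row_of f)^T) 0 0 = \sum_u f u ^+ 2.
Proof. by rewrite mxE -sum_enum_val; apply: eq_bigr => i _; rewrite !mxE. Qed.

Lemma row_of_laplacian f (i : 'I_#|H|) :
  (row_of f *m laplacian R H) 0 i =
  \sum_(v | sedge (enum_val i) v) (f (enum_val i) - f v).
Proof.
rewrite mulmxBr mxE mul_mx_diag !mxE /degree sumrB; congr (_ - _).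
  by rewrite sumr_const mulr_natr; congr (_ *+ _); apply: eq_card => v; rewrite inE.
rewrite [RHS]big_mkcond -sum_enum_val; apply: eq_bigr => j _.
by rewrite !mxE sedge_sym; case: ifP; rewrite ?mulr1 ?mulr0.
Qed.

(** Summation by parts: (f u - f v)^2 = (f u - f v) f u + (f v - f u) f v, and
    the two terms have the same sum over ordered adjacent pairs. *)
Lemma dirichlet_laplacian f :
  dirichlet f = 2 * (row_of f *m laplacian R H *m (row_of f)^T) 0 0.
Proof.
have -> : (row_of f *m laplacian R H *m (row_of f)^T) 0 0 =
    \sum_u \sum_(v | sedge u v) (f u - f v) * f u.
  rewrite mxE -sum_enum_val; apply: eq_bigr => i _.
  by rewrite row_of_laplacian !mxE mulr_suml.
set S := \sum_u _.
have SE : S = \sum_u \sum_(v | sedge u v) (f v - f u) * f v.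
  rewrite /S (exchange_big_dep xpredT) //=; apply: eq_bigr => u _.
  by apply: eq_bigl => v; rewrite sedge_sym.
rewrite mulr_natl mulr2n {2}SE -big_split; apply: eq_bigr => u _ /=.
by rewrite -big_split; apply: eq_bigr => v _ /=; ring.
Qed.

End Dirichlet.

(** * The Rayleigh principle *)

Section Rayleigh.
Local Open Scope sesquilinear_scope.
Context {R : rcfType} {n : nat}.
Local Notation toC := (real_complex R).
Variables (L : 'M[R]_n) (P : 'M[R[i]]_n) (r : 'I_n -> R).
Hypothesis Pu : P \is unitarymx.
Hypothesis LE : map_mx toC L = invmx P *m diag_mx (\row_i toC (r i)) *m P.

Lemma adjointE m p (M : 'M[R[i]]_(m, p)) i j : (M^t*) i j = (M j i)^*.
Proof. by rewrite !mxE. Qed.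

Lemma unitary_sqnorm (X : 'rV[R[i]]_n) :
  (X *m X^t*) 0 0 = \sum_i `|(X *m P^t*) 0 i| ^+ 2.
Proof.
transitivity ((X *m P^t* *m (X *m P^t*)^t*) 0 0).
  rewrite trmx_mul map_mxM trmxCK mulmxA mulmxKtV //.
by rewrite mxE; apply: eq_bigr => i _; rewrite normCK adjointE.
Qed.

Lemma unitary_form (X : 'rV[R[i]]_n) :
  (X *m map_mx toC L *m X^t*) 0 0 = \sum_i toC (r i) * `|(X *m P^t*) 0 i| ^+ 2.
Proof.
rewrite LE invmx_unitary //.
have -> : X *m (P^t* *m diag_mx (\row_i toC (r i)) *m P) *m X^t* =
    (X *m P^t*) *m diag_mx (\row_i toC (r i)) *m (X *m P^t*)^t*.
  by rewrite trmx_mul map_mxM trmxCK !mulmxA.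
rewrite mxE; apply: eq_bigr => i _.
rewrite mul_mx_diag normCK adjointE [X in X * _]mxE [X in _ * X * _]mxE.
by rewrite mulrA [toC _ * _]mulrC.
Qed.

Lemma toCM (a b : R) : toC (a * b) = toC a * toC b.
Proof. exact: rmorphM. Qed.

Lemma toC_entry m p (M : 'M[R]_(m, p)) i j : toC (M i j) = (map_mx toC M) i j.
Proof. by rewrite mxE. Qed.

Lemma toC_mulmx m p q (M : 'M[R]_(m, p)) (N : 'M[R]_(p, q)) :
  map_mx toC (M *m N) = map_mx toC M *m map_mx toC N.
Proof. exact: map_mxM. Qed.

Lemma toC_tr m p (M : 'M[R]_(m, p)) : map_mx toC M^T = (map_mx toC M)^t*.
Proof. by apply/matrixP => i j; rewrite !mxE conj_toC. Qed.

Lemma rayleigh_max b (x : 'rV[R]_n) : (forall i, r i <= b) ->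
  (x *m L *m x^T) 0 0 <= b * (x *m x^T) 0 0.
Proof.
move=> rb; rewrite -lecR toCM !toC_entry !toC_mulmx toC_tr.
rewrite unitary_sqnorm unitary_form mulr_sumr.
by apply: ler_sum => i _; rewrite ler_wpM2r ?exprn_ge0 // lecR.
Qed.

(** A coordinate subspace of the eigenbasis: the form is a combination with
    nonnegative weights of the r i with i != i0. *)
Lemma rayleigh_codim1 b i0 (X : 'rV[R[i]]_n) :
  (forall i, i != i0 -> b <= r i) -> (X *m P^t*) 0 i0 = 0 ->
  toC b * (X *m X^t*) 0 0 <= (X *m map_mx toC L *m X^t*) 0 0.
Proof.
move=> rb X0; rewrite unitary_sqnorm unitary_form mulr_sumr.
apply: ler_sum => i _; have [->|ii0] := eqVneq i i0.
  by rewrite X0 normr0 expr0n !mulr0.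
by rewrite ler_wpM2r ?exprn_ge0 // lecR rb.
Qed.

(** The i0-th eigenvector need not be proportional to e, so x itself need not be
    orthogonal to it. But the plane spanned by x and e
    contains a nonzero vector that is, and rayleigh_codim1 applies to it. For
    alpha x - beta e, the form only sees alpha x, as e is in the kernel, while
    the squared norm only increases, as e is orthogonal to x; so the bound
    for alpha x - beta e gives the one for x when alpha != 0 and 0 < b. If
    alpha = 0, the vector is e itself, on which the form vanishes, and b cannot
    be positive. *)
Lemma rayleigh_second b i0 (e x : 'rV[R]_n) :
  (forall i, i != i0 -> b <= r i) ->
  L^T = L -> e *m L = 0 -> e != 0 -> x *m e^T = 0 ->
  0 <= (x *m L *m x^T) 0 0 -> b * (x *m x^T) 0 0 <= (x *m L *m x^T) 0 0.
Proof.
move=> rb Lsym eL e0 xe psd.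
have sq_ge0 (z : 'rV[R]_n) : 0 <= (z *m z^T) 0 0.
  by rewrite mxE; apply: sumr_ge0 => i _; rewrite mxE -expr2 sqr_ge0.
have [b0|b0] := lerP b 0; first by rewrite (le_trans _ psd) // mulr_le0_ge0.
have esq : 0 < (e *m e^T) 0 0.
  rewrite lt_def sq_ge0 andbT; apply: contraNneq e0 => /eqP.
  rewrite mxE psumr_eq0 => [/allP e0|i _]; last by rewrite mxE -expr2 sqr_ge0.
  apply/eqP/rowP => i; rewrite mxE; apply/eqP.
  by have := e0 i (mem_index_enum i); rewrite mxE -expr2 sqrf_eq0.
set E := map_mx toC e; set X := map_mx toC x; set M := map_mx toC L.
have EM : E *m M = 0 by rewrite -toC_mulmx eL map_mx0.
have ME : M *m E^t* = 0.
  by rewrite -toC_tr -toC_mulmx -[L]Lsym -trmx_mul eL trmx0 map_mx0.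
have XEt : X *m E^t* = 0 by rewrite -toC_tr -toC_mulmx xe map_mx0.
have EXt : E *m X^t* = 0.
  by rewrite -toC_tr -toC_mulmx -[e]trmxK -trmx_mul xe trmx0 map_mx0.
(* The i0-th coordinates of e and x in the eigenbasis. *)
pose alpha := (E *m P^t*) 0 i0; pose beta := (X *m P^t*) 0 i0.
have [a0|a0] := eqVneq alpha 0.
  have := rayleigh_codim1 _ _ _ rb a0; rewrite EM mul0mx [X in _ <= X -> _]mxE.
  rewrite /E -toC_tr -toC_mulmx -toC_entry.
  by rewrite -toCM (_ : (0 : R[i]) = toC 0) // lecR leNgt pmulr_rgt0 ?b0 // esq.
have Z0 : ((alpha *: X - beta *: E) *m P^t*) 0 i0 = 0.
  have lin a c (U V : 'rV[R[i]]_n) :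
      (a *: U - c *: V) 0 i0 = a * U 0 i0 - c * V 0 i0 by rewrite !mxE.
  by rewrite mulmxBl -!scalemxAl lin mulrC subrr.
have := rayleigh_codim1 _ _ _ rb Z0.
have Zt : (alpha *: X - beta *: E)^t* = alpha^* *: X^t* - beta^* *: E^t*.
  by apply/matrixP => i j; rewrite !mxE rmorphB !rmorphM.
rewrite Zt !(mulmxBl, mulmxBr) -!scalemxAl -!scalemxAr.
rewrite -/M EM !mul0mx -(mulmxA X M (E^t*)) ME XEt EXt mulmx0 !scaler0 !subr0 sub0r opprK.
have posa : 0 < `|alpha| ^+ 2 by rewrite exprn_gt0 // normr_gt0.
have addE (U V : 'M[R[i]]_(1, 1)) : (U + V) 0 0 = U 0 0 + V 0 0 by rewrite mxE.
rewrite !scalerA -!normCK addE.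
have scE c (U : 'M[R[i]]_(1, 1)) : (c *: U) 0 0 = c * U 0 0 by rewrite mxE.
rewrite !scE /X /E /M -!toC_tr -!toC_mulmx -!toC_entry.
move=> le1; rewrite -lecR -(ler_pM2l posa); apply: le_trans le1.
rewrite mulrDr mulrCA toCM lerDl.
by rewrite !mulr_ge0 ?exprn_ge0 ?normr_ge0 // ler0c ltW.
Qed.
End Rayleigh.

(** * Rayleigh quotients on graphs *)

Section LaplacianBounds.
Context {R : rcfType} {H : sgraph}.
Implicit Types f : H -> R.

Lemma dirichlet_le_max f :
  dirichlet f <= 2 * (laplacian_eig R H 1 * \sum_u f u ^+ 2).
Proof.
have [P [r [Pu LE specE]]] := laplacian_diagonalization R H.
rewrite dirichlet_laplacian -row_of_sqnorm ler_pM2l ?ltr0n //.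
apply: (rayleigh_max _ _ _ Pu LE) => i.
by rewrite /laplacian_eig specE sort_ge_head // codom_f.
Qed.

(** The constant vector is in the kernel of the Laplacian and orthogonal to f,
    so it plays the role of e in rayleigh_second. *)
Lemma dirichlet_ge_second f : (1 < #|H|)%N -> \sum_u f u = 0 ->
  2 * (laplacian_eig R H #|H|.-1 * \sum_u f u ^+ 2) <= dirichlet f.
Proof.
move=> H1 sumf; have [P [r [Pu LE specE]]] := laplacian_diagonalization R H.
have [i0 ri0] := sort_ge_penultimate R _ r H1.
rewrite dirichlet_laplacian -row_of_sqnorm ler_pM2l ?ltr0n //.
apply: (rayleigh_second _ _ _ Pu LE _ i0 (row_of (fun _ => 1))).
- by move=> i /ri0; rewrite /laplacian_eig specE.
- rewrite linearB /= tr_diag_mx; congr (_ - _).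
  by apply/matrixP => i j; rewrite !mxE sedge_sym.
- apply/rowP => i; rewrite row_of_laplacian mxE.
  by apply: big1 => v _; rewrite subrr.
- apply/eqP => /rowP/(_ (Ordinal (ltnW H1))); rewrite !mxE => /eqP.
  by rewrite oner_eq0.
- apply/matrixP => i j; rewrite !ord1 mxE [RHS]mxE -[RHS]sumf -sum_enum_val.
  by apply: eq_bigr => k _; rewrite !mxE mulr1.
- rewrite -(@pmulr_rge0 _ 2) ?ltr0n // -dirichlet_laplacian.
  exact: dirichlet_ge0.
Qed.

(** The edges between A and its complement are seen from the side of A, hence
    the factor 2. *)
Lemma dirichlet_split f (A : pred H) :
  dirichlet f = 2 * (\sum_(u | A u) \sum_(v | ~~ A v && sedge u v) (f u - f v) ^+ 2)
    + \sum_(u | A u) \sum_(v | A v && sedge u v) (f u - f v) ^+ 2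
    + \sum_(u | ~~ A u) \sum_(v | ~~ A v && sedge u v) (f u - f v) ^+ 2.
Proof.
pose S (B C : pred H) := \sum_(u | B u) \sum_(v | C v && sedge u v) (f u - f v) ^+ 2.
have split B : \sum_(u | B u) \sum_(v | sedge u v) (f u - f v) ^+ 2 =
    S B A + S B (predC A).
  rewrite -big_split; apply: eq_bigr => u _ /=.
  rewrite (bigID A) /=; congr (_ + _); apply: eq_bigl => v; exact: andbC.
have SC : S (predC A) A = S A (predC A).
  rewrite /S (exchange_big_dep A) /=; last by move=> u v _ /andP[].
  apply: eq_bigr => u Au; rewrite [LHS](eq_bigl (fun v => ~~ A v && sedge u v)).
    by apply: eq_bigr => v _; rewrite -sqrrN opprB.
  by move=> v; rewrite Au sedge_sym.
rewrite /dirichlet (bigID A) /= !split SC /S /=; ring.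
Qed.

End LaplacianBounds.

(** * Laplacian eigenvalues and degrees *)

Section DegreeBounds.
Context {R : rcfType} {H : sgraph}.

Lemma dirichlet_two_valued (f : H -> R) (A : pred H) a b :
  (forall u, f u = if A u then a else b) ->
  dirichlet f =
    2 * ((a - b) ^+ 2 * (\sum_(u | A u) #|[set v | ~~ A v && sedge u v]|)%:R).
Proof.
move=> fE; rewrite (dirichlet_split f A).
rewrite [X in _ + X + _]big1; last first.
  by move=> u Au; apply: big1 => v /andP[Av _]; rewrite !fE Au Av subrr expr0n.
rewrite [X in _ + X]big1; last first.
  move=> u /negbTE Au; apply: big1 => v /andP[/negbTE Av _].
  by rewrite !fE Au Av subrr expr0n.
rewrite !addr0; congr (_ * _); rewrite natr_sum mulr_sumr.
apply: eq_bigr => u Au.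
rewrite (eq_bigr (fun _ => (a - b) ^+ 2)); last first.
  by move=> v /andP[/negbTE Av _]; rewrite !fE Au Av.
by rewrite sumr_const mulr_natr; congr (_ *+ _); apply: eq_card => v; rewrite !inE.
Qed.

Lemma degree_le_largest (v : H) : (degree v)%:R <= laplacian_eig R H 1.
Proof.
pose f u : R := if u == v then 1 else 0.
have := dirichlet_le_max f.
rewrite (dirichlet_two_valued f (pred1 v) 1 0) // big_pred1_eq subr0 expr1n mul1r.
have -> : \sum_u f u ^+ 2 = 1.
  rewrite (bigD1 v) //= {1}/f eqxx big1 ?addr0 ?expr1n // => u /negbTE uv.
  by rewrite /f uv expr0n.
rewrite mulr1 ler_pM2l ?ltr0n // /degree => le1; apply: le_trans le1.
rewrite ler_nat; apply/subset_leq_card/subsetP => u; rewrite !inE andbC => vu.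
by rewrite vu; apply: contraTneq vu => ->; rewrite sedge_irrefl.
Qed.

(** The algebraic connectivity is at most the number of vertices that separate
    the graph, here the neighbours of v, which separate v from the set W of its
    non-neighbours. The test vector f is constant on the two sides, with sum 0,
    and vanishes on the separator. Only edges at a neighbour u of v contribute,
    and those at u contribute at most the sum of f x ^+ 2 over all x. *)
Lemma second_le_degree (v w : H) : w != v -> ~~ sedge v w ->
  laplacian_eig R H #|H|.-1 <= (degree v)%:R.
Proof.
move=> wv vw.
have H1 : (1 < #|H|)%N.
  by rewrite (cardD1 v) (cardD1 w) !inE wv.
pose W := [set u | (u != v) && ~~ sedge v u].
pose f u : R := if u == v then #|W|%:R else if sedge v u then 0 else -1.
have fW u : u \in W -> f u = -1.
  by rewrite inE /f => /andP[/negbTE-> /negbTE->].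
have f0 u : sedge v u -> f u = 0.
  by rewrite /f => vu; rewrite vu; case: eqP vu => // ->; rewrite sedge_irrefl.
have sumf : \sum_u f u = 0.
  rewrite (bigD1 v) //= {1}/f eqxx (bigID (mem W)) /=.
  rewrite [X in _ + (_ + X)]big1; last first.
    by move=> u /andP[uv]; rewrite !inE uv /= negbK; exact: f0.
  rewrite addr0 (eq_bigr (fun _ => -1)); last by move=> u /andP[_]; exact: fW.
  apply/eqP; rewrite sumr_const mulNrn subr_eq0; apply/eqP; congr _%:R.
  by apply: eq_card => u; rewrite [RHS]inE !inE; case: eqP.
have normf : 0 < \sum_u f u ^+ 2.
  rewrite (bigD1 w) //= ltr_wpDr //; last first.
    by rewrite fW ?inE ?wv // sqrrN expr1n.
  by apply: sumr_ge0 => u _; exact: sqr_ge0.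
rewrite -(ler_pM2r normf) -(@ler_pM2l _ 2) ?ltr0n //.
apply: (le_trans (dirichlet_ge_second f H1 sumf)).
rewrite (dirichlet_split f (sedge v)).
rewrite [X in _ + X + _]big1; last first.
  by move=> u vu; apply: big1 => x /andP[vx _]; rewrite !f0 // subrr expr0n.
rewrite [X in _ + X]big1; last first.
  move=> u vu; apply: big1 => x /andP[vx ux].
  have uW : u \in W.
    by rewrite inE vu andbT; apply: contraNneq vx => <-.
  have xW : x \in W.
    by rewrite inE vx andbT; apply: contraNneq vu => <-; rewrite sedge_sym.
  by rewrite !fW // subrr expr0n.
rewrite !addr0 ler_pM2l ?ltr0n // /degree cardE mulr_natl.
rewrite -(cardE [set y | sedge v y]) -sumr_const.
rewrite [leRHS](eq_bigl (sedge v)); last by move=> u; rewrite inE.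
(* As f u = 0, the inner sum is one of squares f x ^+ 2 over some of the x. *)
apply: ler_sum => u vu; rewrite [leRHS](bigID (fun x => ~~ sedge v x && sedge u x)) /=.
rewrite ler_wpDr //; first by apply: sumr_ge0 => x _; exact: sqr_ge0.
by apply: ler_sum => x _; rewrite f0 // sub0r sqrrN.
Qed.

End DegreeBounds.

(** * Counting in the total graph *)

Section TotalGraphCounting.
Variable G : sgraph.

Lemma edgeP (A : {set G}) :
  reflect (exists x y, sedge x y /\ A = [set x; y]) (A \in edges G).
Proof.
rewrite inE; apply: (iffP existsP) => [[x /existsP[y /andP[xy /eqP->]]]|[x [y [xy ->]]]].
  by exists x, y.
by exists x; apply/existsP; exists y; rewrite xy eqxx.
Qed.

Lemma card_edge (a : edge_type G) : #|val a| = 2%N.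
Proof.
have /edgeP[x [y [xy ->]]] := valP a.
by rewrite cards2; case: eqP xy => // ->; rewrite sedge_irrefl.
Qed.

Lemma card_edge_type : #|edge_type G| = #|edges G|.
Proof. by rewrite card_sig; apply: eq_card. Qed.

(** The bijection sends a neighbour x of v to the edge joining v and x. *)
Lemma card_incident_edges (v : G) :
  #|[set a : edge_type G | v \in val a]| = degree v.
Proof.
rewrite -(card_imset _ val_inj) /degree -[RHS](card_in_imset (f := fun x => [set v; x])).
  congr #|pred_of_set _|; apply/setP => A; apply/imsetP/imsetP => [[a]|[x]].
    rewrite inE => va ->; have /edgeP[x [y [xy aE]]] := valP a.
    move: va; rewrite aE !inE => /orP[] /eqP vE.
      by exists y; rewrite ?inE vE.
    by exists x; rewrite ?inE vE 1?sedge_sym // setUC.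
  rewrite inE => vx ->; have vxE : [set v; x] \in edges G.
    by apply/edgeP; exists v, x.
  by exists (Sub [set v; x] vxE); rewrite ?inE ?SubK ?inE ?eqxx.
move=> x y; rewrite !inE => vx vy /setP/(_ x); rewrite !inE eqxx orbT.
by case: eqP vx => [->|_ _ /esym/eqP //]; rewrite sedge_irrefl.
Qed.

Lemma card_sum_set (S T : finType) (P : pred (S + T)) :
  #|[set z | P z]| = (#|[set x | P (inl x)]| + #|[set y | P (inr y)]|)%N.
Proof. by rewrite -!sum1dep_card big_sumType. Qed.

Lemma degree_total_vertex (v : G) :
  degree (inl v : total_graph G) = (2 * degree v)%N.
Proof. by rewrite /degree card_sum_set /= card_incident_edges mul2n addnn. Qed.

Lemma card_total_graph : #|total_graph G| = (#|G| + #|edges G|)%N.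
Proof. by rewrite card_sum card_edge_type. Qed.

(** The min is formed in nat, where minn has no neutral element: the initial
    value #|G| has to be seen not to lower it, which max_card does. *)
Lemma min_degree_attained : (0 < #|G|)%N ->
  exists v : G, degree v = min_degree G /\ forall u : G, (degree v <= degree u)%N.
Proof.
case/card_gt0P => x0 _; case: (arg_minnP (@degree G) (i0 := x0) (P := xpredT)).
  by [].
move=> v _ vmin.
exists v; split; last by move=> u; exact: vmin.
apply/eqP; rewrite eqn_leq; apply/andP; split; rewrite /min_degree.
  apply: (big_ind (fun k => degree v <= k)%N) => [|x y vx vy|u _].
  - exact: max_card.
  - by rewrite leq_min vx.
  - exact: vmin.
elim: index_enum (mem_index_enum v) => // u s IHs; rewrite inE big_cons geq_min.
by case/orP => [/eqP->|/IHs ->]; rewrite ?leqnn ?orbT.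
Qed.

Lemma edges_gt0 : connected_graph G -> (1 < #|G|)%N -> (0 < #|edges G|)%N.
Proof.
case=> _ Gconn /card_gt1P[x [y [_ _ xy]]].
have /connectP[[|z p] /=] := Gconn x y; first by move=> _ yx; rewrite yx eqxx in xy.
case/andP => xz _ _; apply/card_gt0P; exists [set x; z].
by apply/edgeP; exists x, z.
Qed.

(** If v, of minimal degree, is adjacent to all other vertices, then G is
    complete; with at least three vertices it has an edge that avoids v, and
    that edge is the required non-neighbour. *)
Lemma total_graph_nonneighbour (v : G) : (2 < #|G|)%N ->
  (forall u : G, degree v <= degree u)%N ->
  exists w : total_graph G, (w != inl v) && ~~ sedge (inl v : total_graph G) w.
Proof.
move=> G3 vmin; case: (pickP (fun x : G => (x != v) && ~~ sedge v x)) => [x xv|vfull].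
  by exists (inl x).
have vE : [set y | sedge v y] = [set~ v].
  apply/setP => y; rewrite !inE; have := vfull y.
  by case: eqP => [->|_ /negbFE]; rewrite ?sedge_irrefl.
have full (u : G) : [set y | sedge u y] = [set~ u].
  apply/eqP; rewrite eqEcard; apply/andP; split.
    by apply/subsetP => y; rewrite !inE; apply: contraTneq => ->; rewrite sedge_irrefl.
  by have := vmin u; rewrite /degree vE !cardsC1.
have : (1 < #|[set~ v]|)%N by rewrite cardsC1 -ltnS prednK // ltnW // ltnW.
case/card_gt1P => x [y []]; rewrite !inE => xv yv xy.
have xyE : [set x; y] \in edges G.
  apply/edgeP; exists x, y; split=> //.
  by have /setP/(_ y) := full x; rewrite !inE eq_sym xy.
exists (inr (Sub [set x; y] xyE)).
by rewrite /= !inE negb_or ![v == _]eq_sym xv.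
Qed.

End TotalGraphCounting.

(** * The vector separating vertices from edges *)

Section VertexEdgeVector.
Context {R : rcfType} (G : sgraph).
Local Notation T := (total_graph G).
Local Notation n := #|G|.
Local Notation m := #|edges G|.

(** Constant on V(G) and on E(G), with values chosen to make the sum vanish. *)
Definition vertex_edge_vector (u : T) : R := if u is inl _ then m%:R else - n%:R.

Lemma vertex_edge_vector_sum : \sum_u vertex_edge_vector u = 0.
Proof.
rewrite big_sumType /= !sumr_const card_edge_type.
by rewrite mulNrn -[_ *+ n]mulr_natl -[_ *+ m]mulr_natl mulrC subrr.
Qed.

Lemma vertex_edge_vector_sqnorm :
  \sum_u vertex_edge_vector u ^+ 2 = n%:R * m%:R * (m%:R + n%:R).
Proof.
rewrite big_sumType /= !sumr_const card_edge_type.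
rewrite -[_ *+ n]mulr_natl -[_ *+ m]mulr_natl.
move: (n%:R : R) (m%:R : R) => x y; ring.
Qed.

(** Seen from the edges: each of the m edges has two ends, and only these 2m
    incidences join the two classes. *)
Lemma vertex_edge_vector_dirichlet :
  dirichlet vertex_edge_vector = 2 * ((m%:R + n%:R) ^+ 2 * (2 * m%:R)).
Proof.
rewrite (dirichlet_two_valued _ (fun u : T => if u is inr _ then true else false)
  (- n%:R) m%:R); last by case.
congr (_ * (_ * _)); first by move: (n%:R : R) (m%:R : R) => x y; ring.
rewrite big_sumType /= big_pred0 // add0n -natrM mulnC -[RHS]/(_ %:R); congr _%:R.
rewrite (eq_bigr (fun _ => 2%N)) => [|a _].
  by rewrite sum_nat_const card_edge_type.
rewrite card_sum_set /= [X in (_ + X)%N]eq_card0 => [|b]; last by rewrite !inE.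
by rewrite addn0 -(card_edge _ a); apply: eq_card => x; rewrite !inE.
Qed.

End VertexEdgeVector.

(** * The bound on the Laplacian spread *)

Theorem theorem26 (R : rcfType) (G : sgraph) (n m delta : nat)
    (hconn : connected_graph G)
    (hn : #|G| = n) (hm : #|edges G| = m) (hdelta : min_degree G = delta)
    (hn3 : (2 < n)%N) :
  `|(2 * m%:R + 2 * n%:R) / n%:R - 2 * delta%:R|
    <= laplacian_spread R (total_graph G).
Proof.
have n0 : 0 < n%:R :> R by rewrite ltr0n ltnW // ltnW.
have m0 : 0 < m%:R :> R by rewrite ltr0n -hm edges_gt0 // hn ltnW.
have T1 : (1 < #|total_graph G|)%N by rewrite card_total_graph hn; lia.
have [v [vdelta vmin]] : exists v : G, degree v = delta /\
    forall u : G, (degree v <= degree u)%N.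
  by rewrite -hdelta; apply: min_degree_attained; rewrite hn; lia.
have vT : (degree (inl v : total_graph G))%:R = 2 * delta%:R :> R.
  by rewrite degree_total_vertex vdelta natrM.
rewrite /laplacian_spread.
set mu1 := laplacian_eig R _ 1; set mu2 := laplacian_eig R _ _.
have max_deg : 2 * delta%:R <= mu1 by rewrite -vT degree_le_largest.
have sec_deg : mu2 <= 2 * delta%:R.
  have [|w /andP[wv vw]] := total_graph_nonneighbour _ v _ vmin; first by rewrite hn.
  by rewrite -vT (second_le_degree _ _ wv).
set a := (_ / _).
have aE : a * (n%:R * m%:R * (m%:R + n%:R)) = (m%:R + n%:R) ^+ 2 * (2 * m%:R).
  rewrite /a; move: n0; move: (n%:R : R) (m%:R : R) => x y x0.
  by field; rewrite gt_eqF.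
(* Without edges, the vector separating vertices from edges would be 0. *)
have pos : 0 < n%:R * m%:R * (m%:R + n%:R) :> R by rewrite !mulr_gt0 ?addr_gt0.
have max_avg : a <= mu1.
  have := dirichlet_le_max (vertex_edge_vector (R := R) G).
  rewrite vertex_edge_vector_dirichlet vertex_edge_vector_sqnorm hn hm -aE.
  by rewrite ler_pM2l ?ltr0n // ler_pM2r.
have sec_avg : mu2 <= a.
  have := dirichlet_ge_second _ T1 (vertex_edge_vector_sum (R := R) G).
  rewrite vertex_edge_vector_dirichlet vertex_edge_vector_sqnorm hn hm -aE.
  by rewrite ler_pM2l ?ltr0n // ler_pM2r.
by rewrite ler_norml; apply/andP; split; lra.
Qed.
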